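(* Assume that $|\chi|=s<\infty$. Let $M\in\mathcal{W}$ be finite dimensional and indecomposable. Then $M\cong V_t(\lambda)$ for some $t\geq 1$ and $\lambda\in\widehat{G}$, or $M\cong V(\lambda,f^r)$ for some $\lambda\in\widehat{G}$, $r\geq 1$ and $f(y)\in\mathrm{Irr}[y]$. Moreover, $M$ is uniserial.
   Context: $k$ is a field, $G$ a group, $\widehat{G}$ the group of characters $G\to k^{\times}$, $\chi\in\widehat{G}$ of order $|\chi|$, and $a\in Z(G)$ with $\chi(a)\neq 1$. $H=kG(\chi^{-1},a,0)$ is the Hopf algebra generated as an algebra by $G$ and $x$ with relations $xg=\chi^{-1}(g)gx$ ($g\in G$), having $k$-basis $\{gx^i\mid g\in G,i\geq 0\}$, with $\Delta(x)=x\otimes a+1\otimes x$, $\varepsilon(x)=0$, $S(x)=-xa^{-1}$, and each $g\in G$ group-like. For an $H$-module $M$ and $\lambda\in\widehat{G}$, $M_{(\lambda)}=\{v\in M\mid g\cdot v=\lambda(g)v\ \forall g\in G\}$. $M$ is a weight module if $M=\bigoplus_{\lambda\in\widehat{G}}M_{(\lambda)}$; $\mathcal{W}$ is the full subcategory of left $H$-modules consisting of all weight modules. For $t\geq 1$ and $\lambda\in\widehat{G}$, $V_t(\lambda)$ is the $t$-dimensional $H$-module with $k$-basis $m_0,\dots,m_{t-1}$ and action $g\cdot m_i=\chi^i(g)\lambda(g)m_i$; $x\cdot m_i=m_{i+1}$ for $0\leq i\leq t-2$; $x\cdot m_{t-1}=0$. $V(\lambda,f)$ (for $|\chi|=s<\infty$):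 for $\lambda\in\widehat{G}$ and a monic polynomial $f(y)=y^n-\sum_{j=0}^{n-1}\alpha_jy^j\in k[y]$ of degree $n\geq 1$, $V(\lambda,f)$ is the $H$-module with $k$-basis $m_0,\dots,m_{ns-1}$ and action $g\cdot m_i=\chi^i(g)\lambda(g)m_i$; $x\cdot m_i=m_{i+1}$ for $0\leq i\leq ns-2$; $x\cdot m_{ns-1}=\sum_{j=0}^{n-1}\alpha_jm_{js}$. $V(\lambda,f^r)$ is this module for the monic polynomial $f(y)^r$. $\mathrm{Irr}[y]$ is the set of monic irreducible polynomials $f(y)\in k[y]$ with $f(y)\neq y$. *)

(* Defs.v *)
From HB Require Import structures.
From mathcomp Require Import all_boot all_order all_algebra finmap.
From mathcomp Require Import monalg ring.

Set Implicit Arguments.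
Unset Strict Implicit.
Unset Printing Implicit Defensive.

Import GRing.Theory.
Local Open Scope ring_scope.

Section Modules.
Variables (R : pzRingType).

Definition submodule (M : lmodType R) (N : M -> Prop) : Prop :=
  [/\ N 0, forall u v, N u -> N v -> N (u + v)
    & forall (a : R) v, N v -> N (a *: v)].

Definition indecomposable (M : lmodType R) : Prop :=
  (exists v : M, v <> 0) /\
  forall N1 N2 : M -> Prop, submodule N1 -> submodule N2 ->
    (forall v, exists u w, [/\ N1 u, N2 w & v = u + w]) ->
    (forall v, N1 v -> N2 v -> v = 0) ->
    (forall v, N1 v -> v = 0) \/ (forall v, N2 v -> v = 0).

Definition uniserial (M : lmodType R) : Prop :=
  forall N1 N2 : M -> Prop, submodule N1 -> submodule N2 ->
    (forall v, N1 v -> N2 v) \/ (forall v, N2 v -> N1 v).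

Definition module_iso (M N : lmodType R) : Prop :=
  exists f : {linear M -> N}, bijective f.

End Modules.

Record Ghat (k : fieldType) (G : groupType) := GroupChar {
  char_fun :> G -> k;
  charM : forall g h : G, char_fun (g * h)%g = char_fun g * char_fun h;
  char_neq0 : forall g : G, char_fun g != 0 }.

Definition char_order (k : fieldType) (G : groupType) (chi : Ghat k G)
    (s : nat) : Prop :=
  [/\ (0 < s)%N, forall g, chi g ^+ s = 1
    & forall m, (0 < m)%N -> (forall g, chi g ^+ m = 1) -> (s <= m)%N].

Lemma char1 (k : fieldType) (G : groupType) (l : Ghat k G) : l 1%g = 1.
Proof.
apply: (mulfI (char_neq0 l 1%g)).
by rewrite -charM mulg1 mulr1.
Qed.

Section LinearExtension.
Variables (k : fieldType) (K : choiceType).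

Definition lext (V : lmodType k) (B : K -> V) (p : {malg k[K]}) : V :=
  \sum_(u <- msupp p) p@_u *: B u.

Lemma lextEw (V : lmodType k) (B : K -> V) p (d : {fset K}) :
  (msupp p `<=` d)%fset -> lext B p = \sum_(u <- d) p@_u *: B u.
Proof.
move=> le; rewrite [LHS](big_fset_incl _ le) => //= u _ /mcoeff_outdom ->.
by rewrite scale0r.
Qed.

Lemma lext_linear (V : lmodType k) (B : K -> V) : linear (lext B).
Proof.
move=> c p q; pose d := (msupp p `|` msupp q)%fset.
have lep : (msupp p `<=` d)%fset by exact: fsubsetUl.
have leq : (msupp q `<=` d)%fset by exact: fsubsetUr.
have ler : (msupp (c *: p + q) `<=` d)%fset.
  by apply: fsubset_trans (msuppD_le _ _) (fsetSU _ (msuppZ_le _ _)).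
rewrite (lextEw _ lep) (lextEw _ leq) (lextEw _ ler) scaler_sumr -big_split /=.
by apply: eq_bigr => u _; rewrite mcoeffD mcoeffZ scalerDl scalerA.
Qed.

HB.instance Definition _ (V : lmodType k) (B : K -> V) :=
  GRing.isLinear.Build k {malg k[K]} V _ (lext B) (lext_linear B).

Lemma lextU (V : lmodType k) (B : K -> V) u : lext B << u >> = B u.
Proof. by rewrite (lextEw _ msuppU_le) big_seq_fset1 mcoeffUU scale1r. Qed.

Lemma lext_comb (V : lmodType k) (B B' B'' : K -> V) (c : k) p :
  (forall u, B'' u = c *: B u + B' u) -> lext B'' p = c *: lext B p + lext B' p.
Proof.
move=> e; rewrite /lext scaler_sumr -big_split /=; apply: eq_bigr => u _.
by rewrite e scalerDr !scalerA mulrC.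
Qed.

Lemma eq_lext (V : lmodType k) (B B' : K -> V) p :
  B =1 B' -> lext B p = lext B' p.
Proof. by move=> e; apply: eq_bigr => u _; rewrite e. Qed.

Lemma lext_ind (V : lmodType k) (f : {malg k[K]} -> V) :
  linear f -> forall p, f p = lext (fun u => f << u >>) p.
Proof.
move=> lf p.
pose F := HB.pack_for {linear {malg k[K]} -> V} f (GRing.isLinear.Build _ _ _ _ f lf).
rewrite {1}[p]monalgE -[f]/(F : _ -> _) raddf_sum; apply: eq_bigr => u _ /=.
rewrite -[f]/(F : _ -> _) -linearZ; congr (F _); apply/malgP => v.
by rewrite mcoeffZ !mcoeffU mulrnAr mulr1.
Qed.

End LinearExtension.

(* The algebra underlying H = kG(chi^-1, a, 0): the pair (g, i) stands for the
   basis element g x^i.  The multiplication is forced by x h = chi^-1(h) h x: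
   (g x^i) (h x^j) = chi^-1(h)^i gh x^(i+j).  Neither the algebra nor its
   modules depend on a, which only enters the comultiplication. *)
Definition Halg (k : fieldType) (G : groupType) (chi : Ghat k G) : Type :=
  {malg k[(G * nat)%type]}.

Section Halg.
Variables (k : fieldType) (G : groupType) (chi : Ghat k G).
Local Notation K := (G * nat)%type.
Local Notation H := (Halg chi).

HB.instance Definition _ := GRing.Lmodule.copy H {malg k[K]}.

Definition kmul (u v : K) : K := ((u.1 * v.1)%g, (u.2 + v.2)%N).
Definition twist (u v : K) : k := (chi v.1)^-1 ^+ u.2.

Definition Hone : H := << (1%g, 0%N) >>.
Definition Hmul (p q : H) : H :=
  lext (fun u => lext (fun v => twist u v *: (<< kmul u v >> : H)) q) p.

Lemma HmulDl p1 p2 q c : Hmul (c *: p1 + p2) q = c *: Hmul p1 q + Hmul p2 q.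
Proof. exact: lext_linear. Qed.

Lemma HmulDr p q1 q2 c : Hmul p (c *: q1 + q2) = c *: Hmul p q1 + Hmul p q2.
Proof. by apply: lext_comb => u; exact: lext_linear. Qed.

Lemma HmulUU u v : Hmul << u >> << v >> = twist u v *: << kmul u v >>.
Proof. by rewrite /Hmul !lextU. Qed.

Lemma linear_HmulZ c p q : Hmul (c *: p) q = c *: Hmul p q.
Proof. by rewrite /Hmul linearZ. Qed.

Lemma linear_HmulZr c p q : Hmul p (c *: q) = c *: Hmul p q.
Proof.
have h0 : Hmul p 0 = 0.
  by have := HmulDr p 0 0 (-1); rewrite scaler0 addr0 scaleN1r addNr.
by have := HmulDr p q 0 c; rewrite addr0 h0 addr0.
Qed.

Lemma kmulA u v w : kmul u (kmul v w) = kmul (kmul u v) w.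
Proof. by rewrite /kmul /= mulgA addnA. Qed.

Lemma twistA u v w :
  twist v w * twist u (kmul v w) = twist u v * twist (kmul u v) w.
Proof.
rewrite /twist /= charM invfM exprMn exprD.
by by ring.
Qed.

Lemma HmulA : associative Hmul.
Proof.
move=> p q r.
have L1 : linear (fun p => Hmul p (Hmul q r)) by move=> c a b; apply: HmulDl.
have L2 : linear (fun p => Hmul (Hmul p q) r).
  by move=> c a b /=; rewrite !HmulDl.
rewrite (lext_ind L1) (lext_ind L2); apply: eq_lext => u {L1 L2}.
have L1 : linear (fun q => Hmul << u >> (Hmul q r)).
  by move=> c a b /=; rewrite HmulDl HmulDr.
have L2 : linear (fun q => Hmul (Hmul << u >> q) r).
  by move=> c a b /=; rewrite HmulDr HmulDl.
rewrite (lext_ind L1) (lext_ind L2); apply: eq_lext => v {L1 L2}.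
have L1 : linear (fun r => Hmul << u >> (Hmul << v >> r)).
  by move=> c a b /=; rewrite !HmulDr.
have L2 : linear (fun r => Hmul (Hmul << u >> << v >>) r).
  by move=> c a b /=; rewrite HmulDr.
rewrite (lext_ind L1) (lext_ind L2); apply: eq_lext => w {L1 L2}.
rewrite !HmulUU linear_HmulZ linear_HmulZr !HmulUU !scalerA kmulA.
by rewrite twistA.
Qed.

Lemma Hmul1 : left_id Hone Hmul.
Proof.
move=> p.
have L1 : linear (fun p => Hmul Hone p) by move=> c a b; apply: HmulDr.
have L2 : linear (fun p : H => p) by [].
rewrite (lext_ind L1) [RHS](lext_ind L2); apply: eq_lext => -[g i].
by rewrite HmulUU /twist /kmul /= expr0 scale1r mul1g add0n.
Qed.

Lemma Hmulr1 : right_id Hone Hmul.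
Proof.
move=> p.
have L1 : linear (fun p => Hmul p Hone) by move=> c a b; apply: HmulDl.
have L2 : linear (fun p : H => p) by [].
rewrite (lext_ind L1) [RHS](lext_ind L2); apply: eq_lext => -[g i].
by rewrite HmulUU /twist /kmul /= char1 invr1 expr1n scale1r mulg1 addn0.
Qed.

Lemma HmulDl' : left_distributive Hmul +%R.
Proof. by move=> p q r; have := HmulDl p q r 1; rewrite !scale1r. Qed.

Lemma HmulDr' : right_distributive Hmul +%R.
Proof. by move=> p q r; have := HmulDr p q r 1; rewrite !scale1r. Qed.

Lemma Hone_neq0 : Hone != 0.
Proof. by rewrite /Hone monalgU_eq0 oner_eq0. Qed.

HB.instance Definition _ := GRing.Zmodule_isNzRing.Build H
  HmulA Hmul1 Hmulr1 HmulDl' HmulDr' Hone_neq0.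

Lemma HscaleAl c (p q : H) : c *: (p * q) = (c *: p) * q.
Proof. by rewrite [RHS]linear_HmulZ. Qed.

HB.instance Definition _ := GRing.Lmodule_isLalgebra.Build k H HscaleAl.

Lemma HscaleAr c (p q : H) : c *: (p * q) = p * (c *: q).
Proof. by rewrite [RHS]linear_HmulZr. Qed.

HB.instance Definition _ := GRing.Lalgebra_isAlgebra.Build k H HscaleAr.

Definition Hg (g : G) : H := << (g, 0%N) >>.
Definition Hx : H := << (1%g, 1%N) >>.

Lemma HgM g h : Hg (g * h)%g = Hg g * Hg h.
Proof. by rewrite [RHS]HmulUU /twist /= expr0 scale1r. Qed.

Lemma Hg1 : Hg 1%g = 1.
Proof. by []. Qed.

Lemma Hxg g : Hx * Hg g = (chi g)^-1 *: (Hg g * Hx).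
Proof.
rewrite [LHS]HmulUU [Hg g * Hx]HmulUU /twist /kmul /= expr1 expr0 scale1r.
by rewrite mul1g mulg1.
Qed.

Lemma Hbasis g i : (<< (g, i) >> : H) = Hg g * Hx ^+ i.
Proof.
have Hxn : Hx ^+ i = << (1%g, i) >>.
  elim: i => [//|i IH]; rewrite exprS IH [LHS]HmulUU /twist /kmul /=.
  by rewrite char1 invr1 expr1n scale1r mul1g.
by rewrite Hxn [RHS]HmulUU /twist /kmul /= expr0 scale1r mulg1 add0n.
Qed.

(* The base field acts on an H-module through k -> H, c |-> c 1. *)
Definition kscale (M : lmodType H) (c : k) (v : M) : M := (c%:A : H) *: v.

Definition finite_dim (M : lmodType H) : Prop :=
  exists n (e : 'I_n -> M), forall v, exists c : 'I_n -> k,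
    v = \sum_i kscale (c i) (e i).

Definition weight_space (M : lmodType H) (lam : Ghat k G) (v : M) : Prop :=
  forall g, Hg g *: v = kscale (lam g) v.

Definition weight_module (M : lmodType H) : Prop :=
  (forall v : M, exists n (lam : 'I_n -> Ghat k G) (w : 'I_n -> M),
     (forall i, weight_space (lam i) (w i)) /\ v = \sum_i w i) /\
  (forall n (lam : 'I_n -> Ghat k G) (w : 'I_n -> M),
     (forall i j, i != j -> ~ (lam i =1 lam j)) ->
     (forall i, weight_space (lam i) (w i)) ->
     \sum_i w i = 0 -> forall i, w i = 0).

(* A k-space with operators for the generators satisfying the defining
   relations of H; it becomes an H-module below. *)
Record Hrep (V : lmodType k) := HRep {
  rg : G -> V -> V;
  rx : V -> V;
  rg_linear : forall g, linear (rg g);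
  rx_linear : linear rx;
  rg1 : forall v, rg 1%g v = v;
  rgM : forall g h v, rg (g * h)%g v = rg g (rg h v);
  rxg : forall g v, rx (rg g v) = (chi g)^-1 *: rg g (rx v) }.

Definition Hmod (V : lmodType k) (r : Hrep V) : Type := V.

Section Hmod.
Variables (V : lmodType k) (r : Hrep V).

HB.instance Definition _ := GRing.Zmodule.copy (Hmod r) V.

Definition ract (u : K) (v : V) : V := rg r u.1 (iter u.2 (rx r) v).
Definition Hact (h : H) (v : Hmod r) : Hmod r := lext (fun u => ract u v) h.

Lemma iter_rx_linear i : linear (iter i (rx r)).
Proof. by elim: i => [|i IH] c u v //=; rewrite IH rx_linear. Qed.

Lemma ract_linear u : linear (ract u).
Proof. by move=> c v w; rewrite /ract iter_rx_linear rg_linear. Qed.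

Lemma linear_scale (f : V -> V) : linear f -> forall c v, f (c *: v) = c *: f v.
Proof.
move=> lf c v; have f0 : f 0 = 0.
  by have := lf (-1) 0 0; rewrite scaler0 addr0 scaleN1r addNr.
by have := lf c v 0; rewrite addr0 f0 addr0.
Qed.

Lemma ractM u v w :
  ract u (ract v w) = twist u v *: ract (kmul u v) w.
Proof.
rewrite /ract /kmul /twist /= rgM iterD.
move: (iter v.2 _ w) => {}w.
suff -> : forall i, iter i (rx r) (rg r v.1 w)
    = (chi v.1)^-1 ^+ i *: rg r v.1 (iter i (rx r) w).
  by rewrite linear_scale //; exact: rg_linear.
elim=> [|i IH]; first by rewrite expr0 scale1r.
rewrite iterS IH (linear_scale (@rx_linear _ r)) rxg scalerA.
by rewrite exprSr.
Qed.

Lemma HactDr h (v w : V) (c : k) :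
  Hact h (c *: v + w : V) = c *: (Hact h v : V) + Hact h w.
Proof. by apply: lext_comb => u; exact: ract_linear. Qed.

Lemma HactA (p q : H) (v : Hmod r) : Hact p (Hact q v) = Hact (p * q) v.
Proof.
have L1 : linear (fun p => Hact p (Hact q v) : V) by exact: lext_linear.
have L2 : linear (fun p => Hact (p * q) v : V).
  by move=> c a b; rewrite [_ * q]HmulDl; exact: lext_linear.
rewrite (lext_ind L1) [RHS](lext_ind L2); apply: eq_lext => u {L1 L2}.
have L1 : linear (fun q => Hact << u >> (Hact q v) : V).
  move=> c a b; rewrite -HactDr; congr Hact; exact: lext_linear.
have L2 : linear (fun q => Hact ((<< u >> : H) * q) v : V).
  by move=> c a b; rewrite [_ * (_ + b)]HmulDr; exact: lext_linear.
rewrite (lext_ind L1) [RHS](lext_ind L2); apply: eq_lext => w {L1 L2}.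
rewrite [_ * _]HmulUU /Hact linearZ !lextU /= lextU.
exact: ractM.
Qed.

Lemma Hact1 (v : Hmod r) : Hact 1 v = v.
Proof. by rewrite /Hact lextU /ract /= rg1. Qed.

Lemma HactDr' : right_distributive Hact +%R.
Proof. by move=> h v w; have := HactDr h v w 1; rewrite !scale1r. Qed.

Lemma HactDl (v : Hmod r) : {morph Hact^~ v : p q / p + q}.
Proof. by move=> p q; rewrite /Hact linearD. Qed.

HB.instance Definition _ := GRing.Zmodule_isLmodule.Build H (Hmod r)
  HactA Hact1 HactDr' HactDl.

Lemma Hmod_g g (v : Hmod r) : Hg g *: v = rg r g v.
Proof. exact: lextU. Qed.

Lemma Hmod_x (v : Hmod r) : Hx *: v = rx r v.
Proof. by rewrite [LHS]lextU /ract /= rg1. Qed.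

Lemma Hmod_k c (v : Hmod r) : kscale c v = c *: (v : V).
Proof. by rewrite /kscale [LHS]linearZ /= [X in _ *: X]lextU /ract /= rg1. Qed.

End Hmod.

(* Modules with k-basis m_0, ..., m_(n-1), here the standard basis of 'rV_n,
   and action g m_i = chi^i(g) lam(g) m_i, x m_i = m_(i+1) for i < n - 1,
   x m_(n-1) = tail.  This respects x g = chi^-1(g) g x iff tail has
   weight chi^n lam. *)
Section Strings.
Variables (n : nat) (lam : Ghat k G) (tail : 'rV[k]_n).
Hypothesis tailP : forall g (j : 'I_n),
  chi g ^+ j * tail 0 j = chi g ^+ n * tail 0 j.

Definition basis_vec (m : nat) : 'rV[k]_n := \row_j (j == m :> nat)%:R.

Definition string_g (g : G) (v : 'rV[k]_n) : 'rV[k]_n :=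
  \row_i (chi g ^+ i * lam g * v 0 i).
Definition string_x (v : 'rV[k]_n) : 'rV[k]_n :=
  \sum_(i < n) v 0 i *: (if (i.+1 < n)%N then basis_vec i.+1 else tail).

Lemma string_g_linear g : linear (string_g g).
Proof. by move=> c u v; apply/rowP => i; rewrite !mxE mulrDr mulrCA. Qed.

Lemma string_x_linear : linear string_x.
Proof.
move=> c u v; rewrite /string_x scaler_sumr -big_split /=.
by apply: eq_bigr => i _; rewrite !mxE scalerDl scalerA.
Qed.

Lemma string_g1 v : string_g 1%g v = v.
Proof. by apply/rowP => i; rewrite !mxE !char1 expr1n !mul1r. Qed.

Lemma string_gM g h v : string_g (g * h)%g v = string_g g (string_g h v).
Proof.
apply/rowP => i; rewrite !mxE !charM exprMn !mulrA; congr (_ * _).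
by rewrite -!mulrA; congr (_ * _); rewrite mulrCA.
Qed.

Lemma string_xg g v :
  string_x (string_g g v) = (chi g)^-1 *: string_g g (string_x v).
Proof.
apply/rowP => j; rewrite !mxE !summxE !mulr_sumr; apply: eq_bigr => i _.
rewrite !mxE; set y := (if _ then _ else _).
have E : chi g ^+ j * y 0 j = chi g ^+ i.+1 * y 0 j.
  rewrite /y; case: ltnP => [_|le].
    by rewrite mxE; case: eqP => [->//|_]; rewrite !mulr0.
  have e : i.+1 = n by apply/eqP; rewrite eqn_leq le ltn_ord.
  by rewrite tailP e.
transitivity ((chi g)^-1 * lam g * v 0 i * (chi g ^+ j * y 0 j)); last by ring.
rewrite E exprS; transitivity
  ((chi g)^-1 * chi g * (chi g ^+ i * lam g * v 0 i * y 0 j)); last by ring.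
by rewrite mulVf ?char_neq0 // mul1r.
Qed.

Definition string_rep : Hrep 'rV[k]_n :=
  HRep string_g_linear string_x_linear string_g1 string_gM string_xg.

Definition string_mod : lmodType H := Hmod string_rep.

Lemma string_mod_g g (i : 'I_n) :
  Hg g *: (basis_vec i : string_mod)
    = kscale (chi g ^+ i * lam g) (basis_vec i : string_mod).
Proof.
rewrite Hmod_g Hmod_k; apply/rowP => j; rewrite !mxE.
by case: eqP => [->//|_]; rewrite !mulr0.
Qed.

Lemma string_mod_x (i : 'I_n) :
  Hx *: (basis_vec i : string_mod)
    = if (i.+1 < n)%N then basis_vec i.+1 else tail.
Proof.
rewrite Hmod_x /= /string_x (bigD1 i) //= mxE eqxx scale1r big1 ?addr0 //.
by move=> j; rewrite mxE -val_eqE => /negbTE /= ->; rewrite scale0r.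
Qed.

End Strings.

Lemma zero_tailP n (g : G) (j : 'I_n) :
  chi g ^+ j * (0 : 'rV[k]_n) 0 j = chi g ^+ n * (0 : 'rV[k]_n) 0 j.
Proof. by rewrite mxE !mulr0. Qed.

Definition V_t (t : nat) (lam : Ghat k G) : lmodType H :=
  string_mod lam (@zero_tailP t).

Section Vf.
Variables (s : nat) (hs : char_order chi s).

(* For monic f = y^n - sum_(j < n) alpha_j y^j one has alpha_j = - f`_j. *)
Definition f_tail (f : {poly k}) : 'rV[k]_((size f).-1 * s) :=
  \sum_(j < (size f).-1) (- f`_j) *: basis_vec _ (j * s).

Lemma f_tailP (f : {poly k}) g (j : 'I_((size f).-1 * s)) :
  chi g ^+ j * f_tail f 0 j = chi g ^+ ((size f).-1 * s) * f_tail f 0 j.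
Proof.
case: hs => _ chis _; rewrite !summxE !mulr_sumr; apply: eq_bigr => i _.
rewrite !mxE; case: eqP => [->|_]; last by rewrite !mulr0.
by rewrite ![(_ * s)%N]mulnC !exprM chis !expr1n.
Qed.

(* Intended for f monic of degree (size f).-1 >= 1. *)
Definition V_f (lam : Ghat k G) (f : {poly k}) : lmodType H :=
  string_mod lam (@f_tailP f).

End Vf.

End Halg.

Definition in_Irr (k : fieldType) (f : {poly k}) : Prop :=
  [/\ f \is monic, irreducible_poly f & f <> 'X].

(* Main.v *)
Require Import Defs.
From HB Require Import structures.
From mathcomp Require Import all_boot all_order all_algebra finmap.
From mathcomp Require Import monalg boolp zify.

(** As far as modules are concerned, H is the group algebra of [G] with a
    variable [x] adjoined that multiplies weights by [chi].  Hence a weight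
    module whose weights all lie in one coset of the subgroup generated by [chi]
    is the same thing as a [Z/s]-graded [k[x]]-module with [x] of degree 1.  The
    ring [k[x]], graded by [Z/s], behaves like a principal ideal domain as soon
    as only homogeneous polynomials are considered: its homogeneous primes are
    [x] and the [f(x^s)] with [f] monic irreducible, [f <> y], and every nonzero
    homogeneous polynomial is, for each such prime [pi], a power of [pi] times a
    polynomial prime to [pi] ([graded_primeX], [graded_prime_comp]).  The theorem
    is the graded form of the classification of indecomposable torsion modules
    over a principal ideal domain.

    Two consequences of indecomposability are used first.  The weights of [M]
    form a single coset ([single_coset]), since the weight vectors inside and
    outside a coset span complementary submodules.  And some power of one [pi]
    kills [M]: [x^s] is central in H, so a factorisation into coprime polynomials
    of a polynomial killing [x^s] splits [M] into two submodules
    ([primary_annihilator]).  The splitting along a coset rests on the fact that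
    the projection onto a set of weights is the action of an element of H
    ([separating_element], [weight_idempotent]); for the same reason every
    submodule is graded.

    Let [pi^r] be the smallest power that kills [M], [v] a weight vector with
    [pi^(r-1) v <> 0], and [m] the degree of [pi^r].  A homogeneous polynomial
    killing [v] is a multiple of [pi^r], because its part prime to [pi] acts
    invertibly; so [v, x v, ..., x^(m-1) v] are linearly independent
    ([powers_free]).  They span a direct summand: take a homogeneous linear form
    [psi] on [M] with [psi (x^i v)] equal to 1 for [i = m-1] and 0 for smaller
    [i].  The matrix of the [psi (x^(i+j) v)] is triangular with ones on the
    antidiagonal, so the largest submodule contained in the kernel of [psi] is a
    complement of [H v].  By indecomposability [M = H v] ([cyclic_generates]).
    The relation [pi^r v = 0] is then the last line of the definition of
    [V_t(lam)] when [pi = x], and of [V(lam, f^r)] when [pi = f(x^s)]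
    ([string_iso]).  Finally a homogeneous vector generates the same submodule as
    some [pi^e v], and these submodules form a chain, whence uniseriality
    ([cyclic_uniserial]). *)

Set Implicit Arguments.
Unset Strict Implicit.
Unset Printing Implicit Defensive.

Import GRing.Theory.
Local Open Scope ring_scope.

(** * Scalars and polynomials acting on a module over an algebra *)

Section Scalars.
Variables (k : fieldType) (A : algType k) (M : lmodType A).
Implicit Types (v w : M) (c d : k) (h : A).

(** For [A = H] this is [kscale]. *)
Definition kact c v : M := c%:A *: v.

Lemma kactA c d v : kact c (kact d v) = kact (c * d) v.
Proof. by rewrite /kact scalerA -scalerAl mul1r scalerA. Qed.

Lemma kact1 v : kact 1 v = v.
Proof. by rewrite /kact !scale1r. Qed.

Lemma kact0 v : kact 0 v = 0.
Proof. by rewrite /kact !scale0r. Qed.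

Lemma kactr0 c : kact c (0 : M) = 0.
Proof. by rewrite /kact scaler0. Qed.

Lemma kactDl c d v : kact (c + d) v = kact c v + kact d v.
Proof. by rewrite /kact !scalerDl. Qed.

Lemma kactBl c d v : kact (c - d) v = kact c v - kact d v.
Proof. by rewrite /kact !scalerBl. Qed.

Lemma kactNl c v : kact (- c) v = - kact c v.
Proof. by rewrite /kact !scaleNr. Qed.

Lemma kactDr c v w : kact c (v + w) = kact c v + kact c w.
Proof. by rewrite /kact scalerDr. Qed.

Lemma kact_sumr (I : Type) (r : seq I) (P : pred I) (F : I -> M) c :
  kact c (\sum_(i <- r | P i) F i) = \sum_(i <- r | P i) kact c (F i).
Proof. by rewrite /kact scaler_sumr. Qed.

Lemma scale_kact h c v : h *: kact c v = kact c (h *: v).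
Proof. by rewrite /kact !scalerA -scalerAr mulr1 -scalerAl mul1r. Qed.

Lemma scaler_kact h c v : (c *: h) *: v = kact c (h *: v).
Proof. by rewrite /kact !scalerA -scalerAl mul1r. Qed.

End Scalars.

Section PolynomialAction.
Variables (k : fieldType) (A : algType k) (M : lmodType A).
Implicit Types (x : A) (v : M) (p q : {poly k}).

Definition pact x q v : M := horner_alg x q *: v.

Lemma pactM x p q v : pact x (p * q) v = pact x p (pact x q v).
Proof. by rewrite /pact rmorphM scalerA. Qed.

Lemma pactD x p q v : pact x (p + q) v = pact x p v + pact x q v.
Proof. by rewrite /pact rmorphD scalerDl. Qed.

Lemma pactB x p q v : pact x (p - q) v = pact x p v - pact x q v.
Proof. by rewrite /pact rmorphB scalerBl. Qed.

Lemma pact0 x v : pact x 0 v = 0.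
Proof. by rewrite /pact rmorph0 scale0r. Qed.

Lemma pact1 x v : pact x 1 v = v.
Proof. by rewrite /pact rmorph1 scale1r. Qed.

Lemma pactX x v : pact x 'X v = x *: v.
Proof. by rewrite /pact horner_algX. Qed.

Lemma pactXn x n v : pact x 'X^n v = x ^+ n *: v.
Proof. by rewrite /pact rmorphXn /= horner_algX. Qed.

Lemma pactC x c v : pact x c%:P v = kact c v.
Proof. by rewrite /pact horner_algC. Qed.

Lemma pactDr x q v w : pact x q (v + w) = pact x q v + pact x q w.
Proof. exact: scalerDr. Qed.

Lemma pact0r x q : pact x q 0 = 0.
Proof. exact: scaler0. Qed.

Lemma pact_comp_Xn x s q v : pact (x ^+ s) q v = pact x (q \Po 'X^s) v.
Proof.
rewrite /pact; congr (_ *: v); elim/poly_ind: q => [|q c IH].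
  by rewrite comp_poly0 !rmorph0.
rewrite comp_polyD comp_polyM comp_polyX comp_polyC !rmorphD !rmorphM /=.
by rewrite rmorphXn /= !horner_algX !horner_algC IH.
Qed.

Lemma pact_poly x n F v :
  pact x (\poly_(i < n) F i) v = \sum_(i < n) kact (F i) (x ^+ i *: v).
Proof.
rewrite /pact poly_def rmorph_sum scaler_suml; apply: eq_bigr => i _.
by rewrite -mul_polyC rmorphM rmorphXn /= horner_algX horner_algC -scalerA.
Qed.

Lemma pact_sum x n q v : (size q <= n)%N ->
  pact x q v = \sum_(i < n) kact q`_i (x ^+ i *: v).
Proof.
move=> sq; rewrite -(pact_poly x n (nth 0 q)); congr (pact x _ v).
apply/polyP => i; rewrite coef_poly; case: ltnP => // ni.
by rewrite nth_default // (leq_trans sq).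
Qed.

End PolynomialAction.

(** * Finite-dimensional modules: bases, linear forms, annihilating polynomials *)

Section Coordinates.
Variables (k : fieldType) (A : algType k) (M : lmodType A).

(** For [A = H] this is [finite_dim]. *)
Definition fin_spanned : Prop := exists n (e : 'I_n -> M),
  forall v, exists c : 'I_n -> k, v = \sum_i kact (c i) (e i).

Definition comb n (e : 'I_n -> M) (x : 'rV[k]_n) : M :=
  \sum_i kact (x 0 i) (e i).

Lemma comb_lin n (e : 'I_n -> M) c x y :
  comb e (c *: x + y) = kact c (comb e x) + comb e y.
Proof.
rewrite /comb kact_sumr -big_split; apply: eq_bigr => i _ /=.
by rewrite !mxE kactDl kactA.
Qed.

Lemma comb0 n (e : 'I_n -> M) : comb e 0 = 0.
Proof. by rewrite /comb big1 // => i _; rewrite mxE kact0. Qed.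

Lemma comb_sum n (e : 'I_n -> M) m (x : 'rV_m) (y : 'I_m -> 'rV_n) :
  comb e (\sum_i x 0 i *: y i) = \sum_i kact (x 0 i) (comb e (y i)).
Proof.
have combD : {morph comb e : a b / a + b}.
  by move=> a b; rewrite -{1}[a]scale1r comb_lin kact1.
rewrite (big_morph _ combD (comb0 e)); apply: eq_bigr => i _.
by rewrite -[_ *: _]addr0 comb_lin comb0 addr0.
Qed.

(** A spanning family that is not free can be shortened, so induction on its
    length ends with a basis. *)
Lemma finite_dim_basis : fin_spanned ->
  exists n (e : 'I_n -> M) (coord : M -> 'rV[k]_n),
    cancel coord (comb e) /\ cancel (comb e) coord.
Proof.
case=> n [e0 span0].
have: exists e : 'I_n -> M, forall v, exists x, v = comb e x.
  exists e0 => v; have [c ->] := span0 v; exists (\row_i c i).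
  by apply: eq_bigr => i _; rewrite mxE.
elim: n {e0 span0} => [|n IH] [e span].
  have [coord coordE] := choice span; exists 0%N, e, coord.
  by split=> x; rewrite -?coordE //; apply/rowP; case.
have [free|] := pselect (forall x, comb e x = 0 -> x = 0).
  have [coord coordE] := choice span; exists n.+1, e, coord.
  split=> x; first by rewrite -coordE.
  apply/eqP; rewrite -subr_eq0; apply/eqP/free.
  rewrite addrC -scaleN1r comb_lin -coordE.
  by rewrite -{2}[comb e x]kact1 -kactDl addNr kact0.
move=> /existsNP[x /not_implyP[x0 /eqP/rV0Pn[i xi]]]; apply: IH.
exists (fun j => e (lift i j)) => v; have [y ->] := span v.
pose z := y - (y 0 i / x 0 i) *: x.
have -> : comb e y = comb e z.
  by rewrite /z addrC -scaleNr comb_lin x0 kactr0 add0r.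
have zi : z 0 i = 0 by rewrite !mxE divfK // subrr.
exists (\row_j z 0 (lift i j)); rewrite /comb (bigD1_ord i) //= zi kact0 add0r.
by apply: eq_bigr => j _; rewrite mxE.
Qed.

Lemma coord_lin n (e : 'I_n -> M) (coord : M -> 'rV[k]_n) :
    cancel coord (comb e) -> cancel (comb e) coord ->
  forall c v w, coord (kact c v + w) = c *: coord v + coord w.
Proof. by move=> cK Kc c v w; rewrite -{1}[v]cK -{1}[w]cK -comb_lin Kc. Qed.

(** The form is a coordinate in a basis extending [u]; concretely, if [B] is the
    matrix of the coordinates of [u], a right inverse of [B] reads off the
    coefficients of a combination of [u]. *)
Lemma free_dual : fin_spanned -> forall m (u : 'I_m -> M),
    (forall x, comb u x = 0 -> x = 0) -> forall i0,
  exists phi : M -> k,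
    (forall c v w, phi (kact c v + w) = c * phi v + phi w)
    /\ (forall i, phi (u i) = (i == i0)%:R).
Proof.
move=> /finite_dim_basis[n [e [coord [cK Kc]]]] m u free i0.
have clin := coord_lin cK Kc.
pose B := \matrix_i coord (u i).
have uE x : comb e (x *m B) = comb u x.
  rewrite mulmx_sum_row comb_sum; apply: eq_bigr => i _.
  by rewrite rowK cK.
have freeB : row_free B.
  rewrite -kermx_eq0; apply/rowV0P => x /sub_kermxP xB; apply: free.
  by rewrite -uE xB comb0.
exists (fun v => (coord v *m pinvmx B) 0 i0); split=> [c v w|i].
  by rewrite clin mulmxDl -scalemxAl !mxE.
have -> : coord (u i) = row i B by rewrite rowK.
by rewrite -row_mul mulmxVp // !mxE.
Qed.

(** Cayley-Hamilton for the matrix of the action of [h] in a basis. *)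
Lemma annihilating_poly (h : A) : fin_spanned ->
  exists2 q : {poly k}, q != 0 & forall v : M, pact h q v = 0.
Proof.
move=> /finite_dim_basis[[|n] [e [coord [cK Kc]]]].
  exists 1; first exact: oner_neq0.
  by move=> v; rewrite -[pact _ _ _]cK /comb big_ord0.
have clin := coord_lin cK Kc.
have c0 : coord 0 = 0.
  by have := clin (-1) 0 0; rewrite kactr0 addr0 scaleN1r addNr.
pose B := \matrix_i coord (h *: e i).
have cD : {morph coord : a b / a + b}.
  by move=> a b; rewrite -{1}[a]kact1 clin scale1r.
have cZ a v : coord (kact a v) = a *: coord v.
  by rewrite -[kact _ _]addr0 clin c0 addr0.
have hE v : coord (h *: v) = coord v *m B.
  rewrite -{1}[v]cK mulmx_sum_row scaler_sumr (big_morph _ cD c0).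
  by apply: eq_bigr => i _; rewrite scale_kact cZ rowK.
have qE q v : coord (pact h q v) = coord v *m horner_mx B q.
  elim/poly_ind: q v => [|q c IH] v.
    by rewrite [horner_mx B 0]rmorph0 mulmx0 pact0.
  rewrite [q * 'X]mulrC [horner_mx B _]rmorphD rmorphM /= horner_mx_X.
  rewrite horner_mx_C mulmxDr mulmxA -hE -IH mul_mx_scalar -cZ -cD.
  by rewrite [_ * q]mulrC pactD pactM pactX pactC.
exists (char_poly B); first exact/monic_neq0/char_poly_monic.
by move=> v; rewrite -[LHS]cK qE Cayley_Hamilton mulmx0 -c0 cK.
Qed.

End Coordinates.

(** * Irreducible factors and homogeneous primes of [k[x]] *)

Section Polynomials.
Variable k : fieldType.
Implicit Types f q h u : {poly k}.

Lemma irreducible_polyX : irreducible_poly ('X : {poly k}).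
Proof. by rewrite -['X]subr0; exact: irredp_XsubC. Qed.

Lemma irreducible_factor q : (1 < size q)%N ->
  exists f, [/\ f \is monic, irreducible_poly f & f %| q].
Proof.
have [n] := ubnP (size q); elim: n q => // n IH q sq q1.
have q0 : q != 0 by rewrite -size_poly_eq0 -lt0n ltnW.
have lq : lead_coef q != 0 by rewrite lead_coef_eq0.
have [irr|] := pselect (irreducible_poly q).
  exists ((lead_coef q)^-1 *: q); split; first by rewrite monicE lead_coefZ mulVf.
    split; first by rewrite size_scale ?invr_eq0.
    move=> d d1; rewrite dvdpZr ?invr_eq0 // => /(irr.2 d d1) dq.
    by apply: eqp_trans dq _; rewrite eqp_sym eqp_scale ?invr_eq0.
  by rewrite dvdpZl ?invr_eq0.
move/not_andP=> [/(_ q1)//|/existsNP[d /not_implyP[d1 /not_implyP[dq /negP dnq]]]].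
have d0 : d != 0 by apply: contraTneq dq => ->; rewrite dvd0p.
have sd : (size d < size q)%N.
  by rewrite ltn_neqAle dvdp_leq // andbT dvdp_size_eqp.
have [||f [fm firr fd]] := IH d; first exact: leq_trans sd sq.
  by rewrite ltn_neqAle eq_sym d1 lt0n size_poly_eq0.
by exists f; split=> //; exact: dvdp_trans fd dq.
Qed.

Lemma irreducible_part f q : irreducible_poly f -> q != 0 ->
  exists e u, q = f ^+ e * u /\ coprimep f u.
Proof.
move=> firr; have [n] := ubnP (size q); elim: n q => // n IH q sq q0.
have [fq|fq] := boolP (f %| q); last first.
  by exists 0%N, q; rewrite mul1r irreducible_poly_coprime.
have f0 := irredp_neq0 firr.
have d0 : q %/ f != 0.
  by apply: contraNneq q0; rewrite -[q in q == 0](divpK fq) => ->; rewrite mul0r.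
have [|e [u [qE cu]]] := IH (q %/ f) _ d0.
  rewrite size_divp //; apply: leq_trans (_ : _ <= size q)%N sq.
  rewrite ltn_subrL size_poly_gt0 q0.
  by have := firr.1; case: (size f) => [|[]].
by exists e.+1, u; split=> //; rewrite -[LHS](divpK fq) qE exprS mulrC mulrA.
Qed.

Lemma coprimep_Bezout f q : coprimep f q -> exists a b, a * f + b * q = 1.
Proof. by move/Bezout_eq1_coprimepP=> [[a b] /= ab1]; exists a, b. Qed.

(** The polynomials ['X^j * (h \Po 'X^s)] are those homogeneous for the grading
    of [k[x]] by [Z/s].  A polynomial [f \Po 'X^s] with [f] irreducible need not
    be irreducible, but among homogeneous polynomials it behaves as if it were. *)
Definition graded_prime (s : nat) (pi : {poly k}) : Prop :=
  forall j h, h != 0 -> exists e u,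
    'X^j * (h \Po 'X^s) = pi ^+ e * u /\ coprimep pi u.

Lemma graded_primeX s : (0 < s)%N -> graded_prime s 'X.
Proof.
move=> s0 j h h0; apply: irreducible_part; first exact: irreducible_polyX.
by apply: mulf_neq0; [rewrite monic_neq0 ?monicXn|rewrite comp_poly_eq0 ?size_polyXn].
Qed.

(** Coprimality to [f] survives the substitution of ['X^s] through the Bezout
    identity, and ['X] is prime to [f \Po 'X^s] because [f] does not vanish at 0. *)
Lemma graded_prime_comp s f : (0 < s)%N -> irreducible_poly f ->
  ~~ ('X %| f) -> graded_prime s (f \Po 'X^s).
Proof.
move=> s0 firr Xf j h h0.
have [e [u [-> cu]]] := irreducible_part firr h0.
exists e, ('X^j * (u \Po 'X^s)); rewrite comp_polyM rmorphXn mulrCA.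
split=> //; rewrite coprimepMr; apply/andP; split.
  rewrite coprimep_expr //= coprimepX /root horner_comp hornerXn expr0n.
  by rewrite gtn_eqF // -/(root f 0) -dvdp_XsubCl subr0.
have [a [b ab1]] := coprimep_Bezout cu.
apply/Bezout_eq1_coprimepP; exists (a \Po 'X^s, b \Po 'X^s) => /=.
by rewrite -!comp_polyM -comp_polyD ab1 comp_polyC.
Qed.

End Polynomials.

(** * Primary decomposition along a central element *)

Section AlgebraPowers.
Variables (R : comNzRingType) (A : algType R).
Implicit Types (x y : A) (q : {poly R}).

Lemma exp_qcomm x y (c : R) i :
  x * y = c *: (y * x) -> x ^+ i * y = c ^+ i *: (y * x ^+ i).
Proof.
move=> xy; elim: i => [|i IH]; first by rewrite !expr0 mul1r mulr1 scale1r.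
by rewrite {1}exprSr -mulrA xy -scalerAr mulrA IH -scalerAl scalerA -mulrA -exprS -exprSr.
Qed.

Lemma comm_scalar x (c : R) : GRing.comm x c%:A.
Proof. by rewrite /GRing.comm -scalerAl -scalerAr mul1r mulr1. Qed.

Lemma comm_horner_alg x y q : GRing.comm x y -> GRing.comm x (horner_alg y q).
Proof.
move=> xy; elim/poly_ind: q => [|q c IH]; first by rewrite rmorph0; exact: commr0.
rewrite rmorphD rmorphM /= horner_algX horner_algC.
by apply: commrD (comm_scalar _ _); exact: commrM.
Qed.

End AlgebraPowers.

Section Primary.
Variables (k : fieldType) (A : algType k) (M : lmodType A).

Lemma submodule_ker (y : A) q : (forall h, GRing.comm h y) ->
  submodule (fun v : M => pact y q v = 0).
Proof.
move=> yc; split=> [|u v u0 v0|h v v0]; first exact: pact0r.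
  by rewrite pactDr u0 v0 addr0.
by rewrite /pact scalerA -comm_horner_alg // -scalerA -/(pact y q v) v0 scaler0.
Qed.

(** Write [q = f^e u] with [u] prime to [f].  The kernels of [f^e] and [u] at [y]
    are complementary submodules, so one of them is zero: either [f^e] kills [M],
    or [u], of smaller degree, does. *)
Lemma primary_annihilator (y : A) q : (forall h, GRing.comm h y) ->
    indecomposable M -> q != 0 -> (forall v : M, pact y q v = 0) ->
  exists f e, [/\ f \is monic, irreducible_poly f
    & forall v : M, pact y (f ^+ e) v = 0].
Proof.
move=> yc [[v0 v0N0] indec]; have [n] := ubnP (size q).
elim: n q => // n IH q sq q0 qM.
have [q1|q1] := leqP (size q) 1.
  have q00 : q`_0 != 0 by rewrite -polyC_eq0 -size1_polyC.
  case: v0N0; rewrite -[v0](pact1 y) -polyC1 -(mulVf q00) polyCM.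
  by rewrite pactM -size1_polyC // qM pact0r.
have [f [fm firr fq]] := irreducible_factor q1.
have [e [u [qE cfu]]] := irreducible_part firr q0.
have [a [b ab1]] := coprimep_Bezout (coprimep_expl e cfu).
have act1 (v : M) : pact y (a * f ^+ e) v + pact y (b * u) v = v.
  by rewrite -pactD ab1 pact1.
have kills p p' (v : M) : q %| p * p' -> pact y p (pact y p' v) = 0.
  move=> /dvdpP[c ppE].
  by rewrite -pactM ppE pactM qM pact0r.
have u0 : u != 0 by apply: contraNneq q0; rewrite qE => ->; rewrite mulr0.
have uq : (size u < size q)%N.
  case: e qE {ab1 act1} => [|e] qE.
    by move: cfu fq; rewrite qE mul1r irreducible_poly_coprime // => /negbTE ->.
  have := size_exp f e.+1; have := firr.1; rewrite qE size_monicM ?monic_exp //.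
  by case: (size f) (size (f ^+ e.+1)%R) (size u) => [|[|sf]] // [|[|sp]] // su; lia.
case: (indec _ _ (submodule_ker (f ^+ e) yc) (submodule_ker u yc)).
- move=> v; exists (pact y (b * u) v), (pact y (a * f ^+ e) v).
    split; last by rewrite addrC act1.
    by apply: kills; rewrite qE mulrCA dvdp_mulIr.
  by apply: kills; rewrite qE mulrCA [u * _]mulrC dvdp_mulIr.
- move=> v fv uv; rewrite -(act1 v).
  by rewrite !pactM fv uv !pact0r addr0.
- move=> ker0; apply: (IH u) => // [|v]; first exact: leq_trans uq sq.
  by apply/ker0/kills; rewrite qE.
- move=> ker0; exists f, e; split=> // v; apply: ker0.
  by apply: kills; rewrite qE mulrC.
Qed.

End Primary.

(** * Graded modules killed by a power of a homogeneous prime *)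

Section GradedModules.
Variables (k : fieldType) (A : algType k) (x : A) (M : lmodType A).
Variables (s : nat) (E : nat -> A).
Implicit Types (v w : M) (q : {poly k}).

Local Notation "q <.> v" := (pact x q v) (at level 40, v at level 39).

(** A [Z/s]-grading of [M] for which [x] has degree 1.  The components are given by
    projections, and these are required to come from elements of [A], so that
    all submodules are graded; the last field says that [A] has no other means of
    moving vectors than scalars, [x] and the projections.  Degrees are natural
    numbers read modulo [s]. *)
Record grading : Prop := Grading {
  period_gt0 : (0 < s)%N;
  projE : forall i j v,
    E j *: (E i *: v) = if i == j %[mod s] then E i *: v else 0;
  sum_proj : forall v, \sum_(i < s) E i *: v = v;
  proj_shift : forall i v, x *: (E i *: v) = E i.+1 *: (x *: v);
  graded_submodule : forall N : M -> Prop,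
    N 0 -> (forall v w, N v -> N w -> N (v + w)) ->
    (forall c v, N v -> N (kact c v)) -> (forall v, N v -> N (x *: v)) ->
    (forall i v, N v -> N (E i *: v)) -> submodule N }.

Hypothesis gr : grading.

Lemma proj_mod i j v : i = j %[mod s] -> E i *: v = E j *: v.
Proof.
move=> ij; rewrite -(sum_proj gr v) !scaler_sumr; apply: eq_bigr => l _.
by rewrite !(projE gr) ij.
Qed.

Lemma proj_shift_exp i j v : x ^+ j *: (E i *: v) = E (j + i) *: (x ^+ j *: v).
Proof.
elim: j => [|j IH]; first by rewrite !scale1r.
by rewrite exprS -!scalerA IH (proj_shift gr).
Qed.

Definition residue_part (j : nat) q : {poly k} :=
  \poly_(i < size q) (if i == j %[mod s] then q`_i else 0).

(** Selecting the coefficients whose index has a given residue modulo [s] is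
    taking a homogeneous component of [k[x]]. *)
Lemma residue_partE j q : exists h, residue_part j q = 'X^(j %% s) * (h \Po 'X^s).
Proof.
have s0 := period_gt0 gr.
exists (\poly_(l < size q) q`_(j %% s + l * s)); apply/polyP => i.
rewrite coefXnM coef_poly coef_comp_poly_Xn //.
case: (ltnP i (j %% s)) => [ij|ji].
  case: ifP => // _; case: ifP => // /eqP e.
  by move: ij; rewrite -e ltnNge leq_mod.
have -> : (i == j %[mod s]) = (s %| i - j %% s)%N.
  by rewrite -eqn_mod_dvd // modn_mod.
case: (boolP (s %| _)%N) => [sd|_]; last by rewrite if_same.
rewrite coef_poly divnK // subnKC //.
case: (ltnP i) => [iq|qi]; last first.
  by rewrite [X in if _ then X else _]nth_default // if_same.
by rewrite (leq_ltn_trans _ iq) // (leq_trans (leq_div _ _)) // leq_subr.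
Qed.

Variable v0 : M.
Hypothesis v0_deg0 : E 0 *: v0 = v0.

Lemma proj_exp_act i j :
  E j *: (x ^+ i *: v0) = if i == j %[mod s] then x ^+ i *: v0 else 0.
Proof.
by rewrite -v0_deg0 proj_shift_exp addn0 (projE gr).
Qed.

Lemma proj_act j q : E j *: (q <.> v0) = residue_part j q <.> v0.
Proof.
rewrite (pact_sum _ _ (leqnn _)) pact_poly scaler_sumr; apply: eq_bigr => i _.
by rewrite scale_kact proj_exp_act; case: ifP; rewrite ?kact0 ?kactr0.
Qed.

Variables (pi : {poly k}) (r : nat).
Hypotheses (pi_monic : pi \is monic) (pi_prime : graded_prime s pi) (r_gt0 : (0 < r)%N).
Hypothesis pi_kills : forall v, (pi ^+ r) <.> v = 0.
Hypothesis pi_v0 : (pi ^+ r.-1) <.> v0 <> 0.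

(** If the polynomial is [pi^e u] with [e < r], then [u] is invertible on [M], so
    [pi^e], hence [pi^(r-1)], would kill [v0]. *)
Lemma homogeneous_annihilator j q :
  residue_part j q <.> v0 = 0 -> pi ^+ r %| residue_part j q.
Proof.
have [h ->] := residue_partE j q.
have [->|h0] := eqVneq h 0; first by rewrite comp_poly0 mulr0 dvdp0.
have [e [u [-> cu]]] := pi_prime (j %% s)%N h0.
have [re _|er] := leqP r e; first by rewrite dvdp_mulr // dvdp_exp2l.
have [a [b ab1]] := coprimep_Bezout (coprimep_expl r cu).
move=> euv; case: pi_v0.
have -> : pi ^+ r.-1 = pi ^+ (r.-1 - e) * pi ^+ e.
  by rewrite -exprD subnK //; move: er r_gt0; case: (r) => //.
rewrite pactM -[pi ^+ e]mul1r -ab1 mulrDl pactD.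
rewrite mulrAC [X in X + _]pactM pi_kills pact0r add0r.
by rewrite -mulrA [u * _]mulrC [X in pact _ _ X]pactM euv !pact0r.
Qed.

Lemma pi_exp_neq0 : pi ^+ r != 0.
Proof. by rewrite monic_neq0 // monic_exp. Qed.

(** The homogeneous components of [q] kill [v0] separately and are thus multiples
    of [pi^r] of degree less than that of [pi^r]. *)
Lemma powers_free q : (size q < size (pi ^+ r))%N -> q <.> v0 = 0 -> q = 0.
Proof.
move=> sq qv; apply/polyP => j; rewrite coef0.
have: pi ^+ r %| residue_part j q.
  by apply: homogeneous_annihilator; rewrite -proj_act qv scaler0.
move=> /dvdp_leq; rewrite leqNgt (leq_ltn_trans _ sq) ?size_poly //.
move=> /contraTeq /(_ isT)/polyP/(_ j).
rewrite coef_poly eqxx coef0; case: ltnP => // qj _.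
by rewrite nth_default.
Qed.

(** The two equalities say that [w] and [pi^e v0] generate the same submodule.  For
    [w] nonzero, [a] is a factor prime to [pi] and [b] its inverse on [M]; the
    zero vector corresponds to [e = r]. *)
Lemma homogeneous_generator j w : (exists q, w = q <.> v0) -> E j *: w = w ->
  exists e a b, w = a <.> (pi ^+ e <.> v0) /\ pi ^+ e <.> v0 = b <.> w.
Proof.
move=> [q ->]; rewrite proj_act; have [h ->] := residue_partE j q => <-.
have [->|h0] := eqVneq h 0.
  by exists r, 0, 0; rewrite comp_poly0 mulr0 pi_kills !pact0.
have [e [u [-> cu]]] := pi_prime (j %% s)%N h0.
have [a [b ab1]] := coprimep_Bezout (coprimep_expl r cu).
exists e, u, b; rewrite [_ * u]mulrC -pactM; split=> //.
have -> : b <.> (u * pi ^+ e <.> v0) = (1 - a * pi ^+ r) * pi ^+ e <.> v0.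
  by rewrite -pactM mulrA -ab1 [X in X - _]addrC addrK.
rewrite mulrBl mul1r pactB mulrAC [X in _ - X]pactM pi_kills.
by rewrite pact0r subr0.
Qed.

(** It suffices to compare homogeneous vectors, and the submodules that these
    generate are among the members of the chain of the [pi^e v0]. *)
Lemma cyclic_uniserial : (forall w, exists q, w = q <.> v0) -> uniserial M.
Proof.
move=> gen N1 N2 sN1 sN2.
have [|/existsNP[w /not_implyP[w1 w2]]] := pselect (forall v, N1 v -> N2 v); first by left.
right=> u u2.
have sumN (N : M -> Prop) v : submodule N -> (forall i, N (E i *: v)) -> N v.
  move=> [N0 ND _] Nv; rewrite -(sum_proj gr v).
  by elim/big_ind: _ => // i _.
have [j jw2] : exists j, ~ N2 (E j *: w).
  by apply: contrapT => /forallNP jw2; apply/w2/(sumN _ _ sN2) => j; apply: contrapT.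
apply: (sumN _ _ sN1) => i; case: sN1 sN2 => [_ _ N1h] [_ _ N2h].
have {}w1 := N1h (E j) _ w1; have {}u2 := N2h (E i) _ u2.
have [|e1 [a1 [b1 [w1E v1E]]]] := homogeneous_generator (j := j) (gen (E j *: w)).
  by rewrite (projE gr) eqxx.
have [|e2 [a2 [b2 [u2E v2E]]]] := homogeneous_generator (j := i) (gen (E i *: u)).
  by rewrite (projE gr) eqxx.
have [le|lt] := leqP e1 e2.
  by rewrite u2E -(subnK le) exprD pactM v1E; do 3! apply: (N1h).
case: jw2; rewrite w1E -(subnK (ltnW lt)) exprD pactM v2E.
by do 3! apply: (N2h).
Qed.

Lemma modp_act q v : (q %% pi ^+ r) <.> v = q <.> v.
Proof.
by rewrite {2}(divp_eq q (pi ^+ r)) pactD pactM pi_kills pact0r add0r.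
Qed.

(** [v0] generates a direct summand, whose complement is the largest submodule in
    the kernel of a homogeneous linear form. *)
Lemma cyclic_generates : fin_spanned M -> indecomposable M ->
  forall w, exists q, w = q <.> v0.
Proof.
move=> finM [_ indec].
have [m sE] : exists m, size (pi ^+ r) = m.+2.
  case e: (size (pi ^+ r)) => [|[|m]]; last by exists m.
    by move/eqP: e; rewrite size_poly_eq0 (negbTE pi_exp_neq0).
  move/eqP/size_poly1P: e => [c _ pE]; have := monic_exp r pi_monic.
  rewrite pE monicE lead_coefC => /eqP c1; case: pi_v0; have := pi_kills v0.
  by rewrite pE c1 pact1 => ->; rewrite pact0r.
have ltp q : (size (q %% pi ^+ r)%R <= m.+1)%N.
  by rewrite -ltnS -sE ltn_modp pi_exp_neq0.
pose u (i : 'I_m.+1) := x ^+ i *: v0.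
have combE y : comb u y = rVpoly y <.> v0.
  rewrite (pact_sum _ _ (size_poly _ _)); apply: eq_bigr => i _.
  by rewrite coef_rVpoly_ord.
have free y : comb u y = 0 -> y = 0.
  rewrite combE => /powers_free y0; rewrite -[y]rVpolyK y0 ?linear0 //.
  by rewrite sE ltnS size_poly.
have [phi [philin phiu]] := free_dual finM free ord_max.
have phi0 : phi 0 = 0.
  by have := philin (-1) 0 0; rewrite kactr0 addr0 mulN1r addNr.
(* composing with the projection makes the form homogeneous, of the degree of
   [x^m v0] *)
pose psi w := phi (E m *: w).
have psiD v w : psi (v + w) = psi v + psi w.
  by rewrite /psi scalerDr -{1}[E m *: v]kact1 philin mul1r.
have psiZ c v : psi (kact c v) = c * psi v.
  by rewrite /psi scale_kact -[kact _ _]addr0 philin phi0 addr0.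
have psi0 : psi 0 = 0 by rewrite /psi scaler0.
have psi_sum n (c : 'I_n -> k) (y : 'I_n -> M) :
    psi (\sum_i kact (c i) (y i)) = \sum_i c i * psi (y i).
  by rewrite (big_morph psi psiD psi0); apply: eq_bigr => i _.
have psiE q : (size q <= m.+1)%N -> psi (q <.> v0) = q`_m.
  move=> sq; rewrite (pact_sum _ _ sq) psi_sum (bigD1 ord_max) //=.
  rewrite /psi proj_exp_act eqxx -[x ^+ m *: v0]/(u ord_max) phiu eqxx mulr1.
  rewrite big1 ?addr0 // => i im; rewrite proj_exp_act.
  case: ifP => _; last by rewrite phi0 mulr0.
  by rewrite -[x ^+ i *: v0]/(u i) phiu (negbTE im) mulr0.
pose C w := exists q, w = q <.> v0.
pose K w := forall j, psi (x ^+ j *: w) = 0.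
have sC : submodule C.
  apply: (graded_submodule gr).
  - by exists 0; rewrite pact0.
  - by move=> _ _ [p ->] [q ->]; exists (p + q); rewrite pactD.
  - by move=> c _ [q ->]; exists (c%:P * q); rewrite pactM pactC.
  - by move=> _ [q ->]; exists ('X * q); rewrite pactM pactX.
  - by move=> i _ [q ->]; exists (residue_part i q); rewrite proj_act.
have sK : submodule K.
  apply: (graded_submodule gr).
  - by move=> j; rewrite scaler0.
  - by move=> v w Kv Kw j; rewrite scalerDr psiD Kv Kw addr0.
  - by move=> c v Kv j; rewrite scale_kact psiZ Kv mulr0.
  - by move=> v Kv j; rewrite scalerA -exprSr.
  - move=> i v Kv j; rewrite proj_shift_exp /psi (projE gr); case: eqP => // e.
    by rewrite (proj_mod _ e); exact: Kv.
have CK w : exists c d, [/\ C c, K d & w = c + d].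
  have [q qP] : exists q, forall j, (j < m.+1)%N -> psi (x ^+ j *: (w - q <.> v0)) = 0.
    have: (m.+1 <= m.+1)%N by [].
    (* the system is triangular: the condition for [x^n] is met by adding a
       multiple of [x^(m-n) v0], which does not affect the conditions before it *)
    elim: {1 3}m.+1 => [|n IH] nm; first by exists 0.
    have [q qP] := IH (ltnW nm).
    pose c := psi (x ^+ n *: (w - q <.> v0)).
    exists (q + c%:P * 'X^(m - n)) => j jn.
    have -> : w - (q + c%:P * 'X^(m - n)) <.> v0
        = (w - q <.> v0) + kact (- c) ('X^(m - n) <.> v0).
      by rewrite pactD opprD addrA pactM pactC kactNl.
    rewrite scalerDr psiD scale_kact psiZ -[X in _ * psi X]pactXn.
    rewrite -[X in _ * psi X]pactM -exprD psiE ?size_polyXn; last by lia.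
    rewrite coefXn; move: jn; rewrite ltnS leq_eqVlt => /orP[/eqP->|jn].
      by rewrite subnKC // eqxx mulr1 /c subrr.
    rewrite qP // (_ : m == _ = false) ?mulr0 ?addr0 //.
    by apply/eqP; lia.
  exists (q <.> v0), (w - q <.> v0); split; [by exists q| |by rewrite addrC subrK].
  move=> j; rewrite -pactXn -modp_act (pact_sum _ _ (ltp _)).
  by rewrite psi_sum big1 // => i _; rewrite qP ?mulr0.
have CK0 w : C w -> K w -> w = 0.
  move=> [q ->]; rewrite -modp_act; set p := q %% _ => Kp.
  have [->|p0] := eqVneq p 0; first by rewrite pact0.
  have sp : (size p <= m.+1)%N by exact: ltp.
  (* multiplying by this power of [x] brings the leading coefficient of [p] to
     degree [m], where [psi] sees it *)
  have := Kp (m.+1 - size p)%N; rewrite -pactXn -pactM psiE; last first.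
    by rewrite size_monicM ?monicXn // size_polyXn addSn /= subnK.
  have sp0 : (0 < size p)%N by rewrite size_poly_gt0.
  rewrite coefXnM ifN -?leqNgt; last by lia.
  rewrite (_ : m - _ = (size p).-1)%N; last by lia.
  by rewrite -lead_coefE => /eqP; rewrite lead_coef_eq0 (negbTE p0).
case: (indec _ _ sC sK CK CK0) => [C0|K0 w].
  by case: pi_v0; apply: C0; exists (pi ^+ r.-1).
by have [c [d [Cc /K0 -> ->]]] := CK w; rewrite addr0.
Qed.

End GradedModules.

(** * Generators and central elements of H *)

Section Generation.
Variables (k : fieldType) (G : groupType) (chi : Ghat k G).
Local Notation H := (Halg chi).

Lemma Halg_ind (P : H -> Prop) :
    (forall p q, P p -> P q -> P (p + q)) ->
    (forall p q, P p -> P q -> P (p * q)) ->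
    (forall c, P c%:A) -> (forall g, P (Hg chi g)) -> P (Hx chi) ->
  forall h, P h.
Proof.
move=> PD PM PC Pg Px h; have lid : linear (@id H) by [].
rewrite (lext_ind lid h) /lext; elim/big_ind: _ => [|//|[g i] _].
  by rewrite -(@scale0r _ H (1 : H)).
rewrite Hbasis -[Hg _ _ * _]mul1r scalerAl.
apply: (PM _ _ _ _) => //; apply: (PM _ _ _ _) => //.
by elim: i => [|i IH]; rewrite ?exprS ?expr0 -?[1](scale1r (1 : H)) //; exact: (PM _ _ _ _).
Qed.

End Generation.

Section HAlgebra.
Variables (k : fieldType) (G : groupType) (chi : Ghat k G).
Local Notation H := (Halg chi).

Lemma Hxg_exp i g : Hx chi ^+ i * Hg chi g = (chi g)^-1 ^+ i *: (Hg chi g * Hx chi ^+ i).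
Proof. exact/exp_qcomm/Hxg. Qed.

Lemma Hx_exp_central s : (forall g, chi g ^+ s = 1) ->
  forall h : H, GRing.comm (Hx chi ^+ s) h.
Proof.
move=> chis; apply: Halg_ind => [p q|p q|c|g|].
- exact: commrD.
- exact: commrM.
- exact: comm_scalar.
- by rewrite /GRing.comm Hxg_exp exprVn chis invr1 scale1r.
- exact/commr_sym/commrX.
Qed.

End HAlgebra.

(** * Weights and projections onto weight components *)

Section Weights.
Variables (k : fieldType) (G : groupType) (chi : Ghat k G).
Local Notation H := (Halg chi).
Variable M : lmodType H.
Implicit Types (mu nu lam : Ghat k G) (v w : M) (h : H) (theta : Ghat k G -> k).

(** This is [weight_space], written with [kact]. *)
Definition has_weight nu v : Prop := forall g, Hg chi g *: v = kact (nu g) v.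

Lemma has_weight0 nu : has_weight nu 0.
Proof. by move=> g; rewrite scaler0 kactr0. Qed.

Lemma has_weightD nu v w : has_weight nu v -> has_weight nu w -> has_weight nu (v + w).
Proof. by move=> vw ww g; rewrite scalerDr vw ww kactDr. Qed.

Lemma eq_has_weight mu nu v : mu =1 nu -> has_weight mu v -> has_weight nu v.
Proof. by move=> e vw g; rewrite vw e. Qed.

(** On weight vectors, such an [h] acts as a function of the weight alone. *)
Definition acts_by h theta : Prop :=
  forall nu w, has_weight nu w -> h *: w = kact (theta nu) w.

Lemma acts_by1 : acts_by 1 (fun=> 1).
Proof. by move=> nu w _; rewrite scale1r kact1. Qed.

Lemma acts_byB h1 h2 t1 t2 :
  acts_by h1 t1 -> acts_by h2 t2 -> acts_by (h1 - h2) (fun nu => t1 nu - t2 nu).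
Proof.
by move=> a1 a2 nu w ww; rewrite scalerBl (a1 _ _ ww) (a2 _ _ ww) kactBl.
Qed.

Lemma acts_by_scale c h theta :
  acts_by h theta -> acts_by (c *: h) (fun nu => c * theta nu).
Proof. by move=> a1 nu w ww; rewrite scaler_kact (a1 _ _ ww) kactA. Qed.

Lemma acts_by_prod n (P : pred 'I_n) (h : 'I_n -> H) (theta : 'I_n -> Ghat k G -> k) :
    (forall i, acts_by (h i) (theta i)) ->
  acts_by (\prod_(i | P i) h i) (fun nu => \prod_(i | P i) theta i nu).
Proof.
move=> a nu w ww; elim/big_rec2: _ => [|i t x _ IH]; first by rewrite scale1r kact1.
by rewrite -scalerA IH scale_kact (a i _ _ ww) kactA mulrC.
Qed.

(** Lagrange interpolation: for each [L i] different from [mu] choose [g] where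
    the two differ, and multiply the elements
    [(g - L i g) / (mu g - L i g)].  The factors need not commute,
    but each of them acts on weight vectors by scalars. *)
Lemma separating_element mu n (L : 'I_n -> Ghat k G) : exists h theta,
  [/\ acts_by h theta, forall nu nu', nu =1 nu' -> theta nu = theta nu', theta mu = 1
    & forall i, ~ L i =1 mu -> theta (L i) = 0].
Proof.
have /choice[h hP] (i : 'I_n) : exists h : H * (Ghat k G -> k),
   [/\ acts_by h.1 h.2, forall nu nu', nu =1 nu' -> h.2 nu = h.2 nu', h.2 mu = 1
    & ~ L i =1 mu -> h.2 (L i) = 0].
  have [e|] := pselect (L i =1 mu).
    by exists (1, fun=> 1); split=> //; exact: acts_by1.
  move=> /existsNP[g /eqP ng]; have ng0 : mu g - L i g != 0 by rewrite subr_eq0 eq_sym.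
  exists ((mu g - L i g)^-1 *: (Hg chi g - L i g *: 1),
          fun nu => (mu g - L i g)^-1 * (nu g - L i g * 1)); split=> /=.
  - apply/acts_by_scale/acts_byB; last exact/acts_by_scale/acts_by1.
    by move=> nu w ww; exact: ww.
  - by move=> nu nu' ->.
  - by rewrite mulr1 mulVf.
  - by rewrite mulr1 subrr mulr0.
exists (\prod_i (h i).1), (fun nu => \prod_i (h i).2 nu); split.
- by apply: acts_by_prod => i; case: (hP i).
- by move=> nu nu' e; apply: eq_bigr => i _; case: (hP i) => _ ext _ _; exact: ext.
- by apply: big1 => i _; case: (hP i).
- by move=> i ne; rewrite (bigD1 i) //=; case: (hP i) => _ _ _ -> //; rewrite mul0r.
Qed.

Lemma weight_span : weight_module M -> finite_dim M ->
  exists n (L : 'I_n -> Ghat k G) (b : 'I_n -> M),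
    (forall i, has_weight (L i) (b i)) /\
    (forall v, exists c : 'I_n -> k, v = \sum_i kact (c i) (b i)).
Proof.
move=> [wM _] [d [e span]].
have /choice[f fP] (j : 'I_d) :
    exists f : {n : nat & 'I_n -> Ghat k G * M}%type,
    (forall i, has_weight (tagged f i).1 (tagged f i).2) /\
    e j = \sum_i (tagged f i).2.
  have [n [L [w [ww ej]]]] := wM (e j).
  by exists (existT (fun n => 'I_n -> Ghat k G * M)%type n (fun i => (L i, w i))).
pose I : finType := {j : 'I_d & 'I_(tag (f j))}.
pose Lw (p : I) := tagged (f (tag p)) (tagged p).
exists #|I|, (fun p => (Lw (enum_val p)).1), (fun p => (Lw (enum_val p)).2).
split=> [p|v]; first exact: (fP (tag (enum_val p))).1.
have [c ->] := span v; exists (fun p => c (tag (enum_val p))).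
transitivity (\sum_(p : I) kact (c (tag p)) (Lw p).2); last first.
  exact: (big_enum_val (fun p : I => kact (c (tag p)) (Lw p).2)).
transitivity (\sum_j \sum_i kact (c j) (tagged (f j) i).2).
  by apply: eq_bigr => j _; rewrite -[LHS]/(kact (c j) (e j)) (fP j).2 kact_sumr.
exact: (sig_big_dep predT (fun=> predT) (fun j i => kact (c j) (tagged (f j) i).2)).
Qed.

Lemma weight_module_ind : weight_module M -> forall N : M -> Prop,
    N 0 -> (forall v w, N v -> N w -> N (v + w)) ->
    (forall nu w, has_weight nu w -> N w) ->
  forall v, N v.
Proof.
move=> [wM _] N N0 ND Nw v; have [n [L [w [ww ->]]]] := wM v.
by elim/big_ind: _ => // i _; apply: (Nw (L i)) => h; exact: ww.
Qed.

(** The weights of [M] are among the finitely many [L i] of a spanning family of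
    weight vectors.  With [e i] separating [L i] from the others, the product of
    the [1 - e i] over the [i] with [S (L i)] kills the weight vectors with weight in
    [S] and fixes the others. *)
Lemma weight_idempotent (S : Ghat k G -> Prop) : weight_module M -> finite_dim M ->
    (forall mu nu, mu =1 nu -> S mu -> S nu) ->
  exists h, forall nu w, has_weight nu w ->
    (S nu -> h *: w = w) /\ (~ S nu -> h *: w = 0).
Proof.
move=> wM fM Sext; have [n [L [b [bw span]]]] := weight_span wM fM.
have /choice[e /choice[t et]] (i : 'I_n) := separating_element (L i) L.
pose h := 1 - \prod_(i | `[< S (L i) >]) (1 - e i).
have hP : acts_by h (fun nu => 1 - \prod_(i | `[< S (L i) >]) (1 - t i nu)).
  apply: (acts_byB acts_by1); apply: acts_by_prod => i; apply: (acts_byB acts_by1).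
  by case: (et i).
exists h => nu w ww.
(* only the basis vectors of weight [nu] contribute to [w] *)
have [c wE] : exists c : 'I_n -> k, w = \sum_(i | `[< L i =1 nu >]) kact (c i) (b i).
  have [d [theta [dP text theta1 theta0]]] := separating_element nu L.
  have [c cE] := span w; exists c; rewrite -[LHS]kact1 -theta1 -(dP _ _ ww).
  rewrite [in LHS]cE scaler_sumr [RHS]big_mkcond /=; apply: eq_bigr => i _.
  rewrite scale_kact (dP _ _ (bw i)); case: asboolP => [Li|/theta0 ->].
    by rewrite (text _ _ Li) theta1 kact1.
  by rewrite kact0 kactr0.
split=> Snu; rewrite {1}wE scaler_sumr; last first.
  apply: big1 => i /asboolP Li; rewrite scale_kact (hP _ _ (bw i)).
  rewrite big1 ?subrr ?kact0 ?kactr0 // => j /asboolP Sj.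
  case: (et j) => _ text _ t0.
  by rewrite t0 ?subr0 // => Lij; apply: Snu; apply: Sext Sj => g; rewrite -Li Lij.
rewrite [RHS]wE; apply: eq_bigr => i /asboolP Li; rewrite scale_kact (hP _ _ (bw i)).
rewrite (bigD1 i) /=; last by apply/asboolP/Sext/Snu => g; rewrite Li.
by case: (et i) => _ _ -> _; rewrite subrr mul0r subr0 kact1.
Qed.

End Weights.

(** * The grading of an indecomposable weight module *)

Lemma rVpoly_basis_vec (k : fieldType) n m :
  (m < n)%N -> rVpoly (basis_vec k n m) = 'X^m.
Proof.
move=> mn; rewrite -(rVpoly_delta _ (Ordinal mn)); congr rVpoly.
by apply/rowP => j; rewrite !mxE.
Qed.

Section WeightGrading.
Variables (k : fieldType) (G : groupType) (chi : Ghat k G) (s : nat).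
Hypothesis hs : char_order chi s.
Implicit Types (lam nu : Ghat k G).

Lemma char_shiftM lam i (g h : G) :
  chi (g * h)%g ^+ i * lam (g * h)%g = (chi g ^+ i * lam g) * (chi h ^+ i * lam h).
Proof. by rewrite !charM exprMn mulrACA. Qed.

Lemma char_shift_neq0 lam i (g : G) : chi g ^+ i * lam g != 0.
Proof. by rewrite mulf_neq0 ?expf_neq0 ?char_neq0. Qed.

Definition char_shift lam i : Ghat k G :=
  GroupChar (char_shiftM lam i) (char_shift_neq0 lam i).

(** The [chi^i lam] with [i < s] are distinct and exhaust the coset, because [s] is
    the exact order of [chi]. *)
Lemma char_shift_eq lam i j :
  char_shift lam i =1 char_shift lam j <-> i = j %[mod s].
Proof.
have [s0 chis smin] := hs.
have chi_mod g n : chi g ^+ n = chi g ^+ (n %% s).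
  by rewrite {1}(divn_eq n s) exprD mulnC exprM chis expr1n mul1r.
split=> [e|ij g]; last by rewrite /= chi_mod ij -chi_mod.
wlog ij: i j e / (i <= j)%N.
  by move=> W; case/orP: (leq_total i j) => /W; [apply|move=> H; apply/esym/H=> g; rewrite e].
apply/esym/eqP; rewrite eqn_mod_dvd // /dvdn; apply: contraT; rewrite -lt0n => r0.
have: (s <= (j - i) %% s)%N; last by rewrite leqNgt ltn_mod s0.
apply: smin => // g; rewrite -chi_mod; apply: (mulIf (char_shift_neq0 lam i g)).
by rewrite mulrA -exprD subnK // mul1r; have := e g.
Qed.

Variable M : lmodType (Halg chi).

Lemma weight_x nu (v : M) : has_weight nu v -> has_weight (char_shift nu 1) (Hx chi *: v).
Proof.
move=> vw g; have := congr1 (fun h => kact (chi g) (h *: v)) (Hxg chi g).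
rewrite -scalerA vw scale_kact kactA => ->.
by rewrite scaler_kact kactA divff ?char_neq0 // kact1 scalerA.
Qed.

Lemma weight_x_exp nu (v : M) i :
  has_weight nu v -> has_weight (char_shift nu i) (Hx chi ^+ i *: v).
Proof.
move=> vw; elim: i => [|i IH].
  by rewrite scale1r; apply: eq_has_weight vw => g; rewrite /= mul1r.
rewrite exprS -scalerA; apply: eq_has_weight (weight_x IH) => g.
by rewrite /= expr1 mulrA -exprS.
Qed.

(** The idempotent [e] attached to the coset of [lam] commutes with H, because
    multiplication by [x] preserves cosets; the image and the kernel of [e] are
    then complementary submodules, and [v0] lies in the image. *)
Lemma single_coset lam (v0 : M) : weight_module M -> finite_dim M -> indecomposable M ->
    v0 <> 0 -> has_weight lam v0 ->
  forall nu (w : M), has_weight nu w -> w <> 0 -> exists i, nu =1 char_shift lam i.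
Proof.
move=> wM fM [_ indec] v00 v0w nu w ww w0; apply: contrapT => nS.
pose S nu := exists i, nu =1 char_shift lam i.
have Sext (mu nu' : Ghat k G) : mu =1 nu' -> S mu -> S nu'.
  by move=> e [i Si]; exists i => g; rewrite -e Si.
have Sx (nu' : Ghat k G) : S (char_shift nu' 1) <-> S nu'.
  have [s0 chis _] := hs; split=> [[i Si]|[i Si]]; last first.
    by exists i.+1 => g; rewrite /= expr1 Si /= exprS mulrA.
  exists (i + s.-1)%N => g; apply: (mulfI (char_neq0 chi g)).
  have := Si g; rewrite /= expr1 => ->.
  by rewrite mulrA -exprS -addnS prednK // exprD chis mulr1.
have [e eP] := weight_idempotent wM fM Sext.
have eC h (v : M) : e *: (h *: v) = h *: (e *: v).
  elim/Halg_ind: h v => [p q IHp IHq|p q IHp IHq|c|g|] v.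
  - by rewrite !scalerDl scalerDr IHp IHq.
  - by rewrite -!scalerA IHp IHq.
  - exact: scale_kact.
  - elim/(weight_module_ind wM): v => [|v w' ev ew|mu v vw].
    + by rewrite !scaler0.
    + by rewrite !scalerDr ev ew.
    + rewrite vw scale_kact; have [Sm|Sm] := pselect (S mu).
        by rewrite !((eP _ _ vw).1 Sm) vw.
      by rewrite ((eP _ _ vw).2 Sm) kactr0 scaler0.
  - elim/(weight_module_ind wM): v => [|v w' ev ew|mu v vw].
    + by rewrite !scaler0.
    + by rewrite !scalerDr ev ew.
    + have xw := weight_x vw; have [Sm|Sm] := pselect (S mu).
        by rewrite ((eP _ _ vw).1 Sm) ((eP _ _ xw).1 ((Sx mu).2 Sm)).
      by rewrite ((eP _ _ vw).2 Sm) scaler0 ((eP _ _ xw).2) // => /(Sx mu).1.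
have sub1 : submodule (fun v : M => e *: v = v).
  split=> [|v w' ev ew|h v ev]; first exact: scaler0.
    by rewrite scalerDr ev ew.
  by rewrite eC ev.
have sub0 : submodule (fun v : M => e *: v = 0).
  split=> [|v w' ev ew|h v ev]; first exact: scaler0.
    by rewrite scalerDr ev ew addr0.
  by rewrite eC ev scaler0.
have ee (v : M) : e *: (e *: v) = e *: v.
  elim/(weight_module_ind wM): v => [|v w' ev ew|mu v vw].
  - by rewrite !scaler0.
  - by rewrite !scalerDr ev ew.
  - have [Sm|Sm] := pselect (S mu).
      by rewrite !((eP _ _ vw).1 Sm).
    by rewrite ((eP _ _ vw).2 Sm) scaler0.
case: (indec _ _ sub1 sub0) => [v|v -> //|c1|c0].
- exists (e *: v), (v - e *: v); split=> //; last by rewrite addrC subrK.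
  by rewrite scalerBr ee subrr.
- by apply: v00; apply: c1; apply: (eP _ _ v0w).1; exists 0%N => g; rewrite /= mul1r.
- by apply: w0; apply: c0; apply: (eP _ _ ww).2.
Qed.

(** The component of degree [i] is the weight space of [chi^i lam]; degrees start
    at the weight of [v0]. *)
Lemma weight_grading lam (v0 : M) : weight_module M -> finite_dim M -> indecomposable M ->
    v0 <> 0 -> has_weight lam v0 ->
  exists E : nat -> Halg chi, grading (Hx chi) M s E /\ E 0%N *: v0 = v0.
Proof.
move=> wM fM indec v00 v0w; have [s0 chis _] := hs.
have Sext i (mu nu : Ghat k G) :
  mu =1 nu -> mu =1 char_shift lam i -> nu =1 char_shift lam i.
  by move=> e m g; rewrite -e m.
have /choice[E EP] i := weight_idempotent wM fM (Sext i).
have Ein i nu (w : M) : nu =1 char_shift lam i -> has_weight nu w -> E i *: w = w.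
  by move=> e /(EP i) [+ _]; exact.
have Eout i nu (w : M) : ~ nu =1 char_shift lam i -> has_weight nu w -> E i *: w = 0.
  by move=> e /(EP i) [_ +]; exact.
have Ew i (v : M) : has_weight (char_shift lam i) (E i *: v).
  elim/(weight_module_ind wM): v => [|v w Nv Nw|nu w ww].
  - by rewrite scaler0; exact: has_weight0.
  - by rewrite scalerDr; exact: has_weightD.
  - have [e|ne] := pselect (nu =1 char_shift lam i).
      by rewrite (Ein _ _ _ e ww); exact: eq_has_weight e ww.
    by rewrite (Eout _ _ _ ne ww); exact: has_weight0.
have Esum (v : M) : \sum_(i < s) E i *: v = v.
  elim/(weight_module_ind wM): v => [|v w Nv Nw|nu w ww].
  - by apply: big1 => i _; rewrite scaler0.
  - rewrite -{2}Nv -{2}Nw -big_split /=.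
    by apply: eq_bigr => i _; rewrite scalerDr.
  - have [->|/eqP w0] := eqVneq w 0.
      by apply: big1 => i _; rewrite scaler0.
    have [i ni] := single_coset wM fM indec v00 v0w ww w0.
    pose i0 := Ordinal (ltn_pmod i s0).
    have ni0 : nu =1 char_shift lam i0.
      by move=> g; rewrite ni; apply: (char_shift_eq lam _ _).2; rewrite /= modn_mod.
    rewrite (bigD1 i0) //= (Ein _ _ _ ni0 ww) big1 ?addr0 // => j /eqP ji.
    apply: Eout ww => nj; apply: ji; apply: val_inj; rewrite /= -(modn_small (ltn_ord j)).
    by apply/(char_shift_eq lam) => g; rewrite -nj ni.
exists E; split; last first.
  by apply: Ein v0w => g; rewrite /= mul1r.
split=> //.
- move=> i j v; case: eqP => [/esym/(char_shift_eq lam) ij|ij].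
    by apply: Ein (Ew i v) => g; rewrite -ij.
  by apply: Eout (Ew i v) => /(char_shift_eq lam).
- move=> i v.
  elim/(weight_module_ind wM): v => [|v w Nv Nw|nu w ww].
  + by rewrite !scaler0.
  + by rewrite !scalerDr Nv Nw.
  + have [e|ne] := pselect (nu =1 char_shift lam i).
      rewrite (Ein _ _ _ e ww) (Ein _ _ _ _ (weight_x ww)) // => g.
      by rewrite /= e /= expr1 mulrA -exprS.
    rewrite (Eout _ _ _ ne ww) scaler0 (Eout _ _ _ _ (weight_x ww)) // => e; apply: ne => g.
    by apply: (mulfI (char_neq0 chi g)); have := e g; rewrite /= expr1 exprS -mulrA.
- move=> N N0 ND NZ Nx NE; split=> // h v.
  elim/Halg_ind: h v => [p q Np Nq|p q Np Nq|c|g|] v Nv.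
  + by rewrite scalerDl; apply: ND; [exact: Np|exact: Nq].
  + by rewrite -scalerA; apply/Np/Nq.
  + exact: NZ.
  + rewrite -[v]Esum scaler_sumr; elim/big_ind: _ => // i _.
    by rewrite Ew; apply/NZ/NE.
  + exact: Nx.
Qed.

(** A module with a weight generator whose first [n] powers [x^i v] form a basis is
    determined by the value of [x^n v]. *)
Lemma string_iso lam n (tail : 'rV[k]_n)
    (tailP : forall g (j : 'I_n), chi g ^+ j * tail 0 j = chi g ^+ n * tail 0 j) (v : M) :
    has_weight lam v ->
    (forall w : M, exists2 q : {poly k}, (size q <= n)%N & w = pact (Hx chi) q v) ->
    (forall q : {poly k}, (size q <= n)%N -> pact (Hx chi) q v = 0 -> q = 0) ->
    Hx chi ^+ n *: v = pact (Hx chi) (rVpoly tail) v ->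
  module_iso M (string_mod lam tailP).
Proof.
move=> vw gen free tailE.
pose act (q : {poly k}) : M := pact (Hx chi) q v.
have actD p q : act (p + q) = act p + act q by exact: pactD.
have actB p q : act (p - q) = act p - act q by exact: pactB.
have act0 : act 0 = 0 by exact: pact0.
pose F (c : string_mod lam tailP) : M := act (rVpoly (c : 'rV[k]_n)).
have FE (c : 'rV[k]_n) : F c = \sum_i kact (c 0 i) (Hx chi ^+ i *: v).
  rewrite /F /act (pact_sum _ _ (size_poly _ _)); apply: eq_bigr => i _.
  by rewrite coef_rVpoly_ord.
have FD : {morph F : c d / c + d}.
  by move=> c d; rewrite -[RHS]actD; congr act; exact: linearD.
have FZ a (c : 'rV[k]_n) : F (a *: c) = kact a (F c).
  by rewrite !FE kact_sumr; apply: eq_bigr => i _; rewrite mxE kactA.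
have F0 : F 0 = 0 by rewrite -[RHS]act0; congr act; exact: linear0.
have Fh h c : F (h *: c) = h *: F c.
  elim/Halg_ind: h c => [p q Fp Fq|p q Fp Fq|a|g|] c.
  - by rewrite !scalerDl FD Fp Fq.
  - by rewrite -!scalerA Fp Fq.
  - by rewrite -[a%:A *: c]/(kscale a c) Hmod_k FZ.
  - rewrite Hmod_g !FE scaler_sumr; apply: eq_bigr => i _.
    by rewrite scale_kact (weight_x_exp i vw) kactA /= mxE mulrC.
  - rewrite Hmod_x [in RHS]FE scaler_sumr /= /string_x (big_morph F FD F0).
    apply: eq_bigr => i _; rewrite FZ scale_kact scalerA -exprS; congr kact.
    case: ifP => [ni|/negbT]; last first.
      rewrite -leqNgt => ni; have -> : i.+1 = n by apply/eqP; rewrite eqn_leq ni ltn_ord.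
      by rewrite tailE.
    by rewrite /F (rVpoly_basis_vec _ ni); exact: pactXn.
have Fz : linear F by move=> h c d; rewrite FD Fh.
pose FL := HB.pack_for {linear string_mod lam tailP -> M} F
  (GRing.isLinear.Build _ _ _ _ F Fz).
have /choice[q qP] (w : M) : exists q : {poly k}, (size q <= n)%N /\ w = pact (Hx chi) q v.
  by have [q sq qw] := gen w; exists q.
pose Gi (w : M) : string_mod lam tailP := poly_rV (q w).
have GK : cancel Gi FL.
  by move=> w; rewrite /= /F poly_rV_K; case: (qP w).
have FK : cancel FL Gi.
  move=> c; apply: (can_inj rVpolyK); apply/eqP; rewrite -subr_eq0; apply/eqP/free.
    by rewrite -linearB; exact: size_poly.
  by rewrite -[LHS]/(act _) actB; apply/eqP; rewrite subr_eq0; apply/eqP/(GK (FL c)).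
have GL : linear Gi := can2_linear FK GK.
pose GLin := HB.pack_for {linear M -> string_mod lam tailP} Gi
  (GRing.isLinear.Build _ _ _ _ Gi GL).
by exists GLin; exists FL.
Qed.

(** Here [r] is the least exponent for which [pi^r] kills [M]: then [pi^(r-1)] does
    not kill all weight vectors, and one that survives generates [M]. *)
Lemma primary_cyclic (pi : {poly k}) N :
    weight_module M -> finite_dim M -> indecomposable M ->
    pi \is monic -> graded_prime s pi ->
    (forall v : M, pact (Hx chi) (pi ^+ N) v = 0) ->
  uniserial M /\ exists r lam (v0 : M),
    [/\ (0 < r)%N, has_weight lam v0,
        forall w, exists2 q : {poly k}, (size q < size (pi ^+ r))%N
          & w = pact (Hx chi) q v0,
        forall q : {poly k}, (size q < size (pi ^+ r))%N ->
          pact (Hx chi) q v0 = 0 -> q = 0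
      & pact (Hx chi) (pi ^+ r) v0 = 0].
Proof.
move=> wM fM indec pim pip piN.
pose P n := `[< forall v : M, pact (Hx chi) (pi ^+ n) v = 0 >].
have [r /asboolP pir rmin] := ex_minnP (ex_intro P N (asboolT piN)).
have r0 : (0 < r)%N.
  rewrite lt0n; apply/eqP => rz; case: indec => [[v v0] _]; apply: v0.
  by have := pir v; rewrite rz expr0 pact1.
have [lam [v0 [v0w v0N]]] : exists lam (v0 : M), has_weight lam v0
    /\ pact (Hx chi) (pi ^+ r.-1) v0 <> 0.
  apply: contrapT => none; suff: (r <= r.-1)%N by rewrite leqNgt prednK ?leqnn.
  apply/rmin/asboolP => v.
  elim/(weight_module_ind wM): v => [|v w v0 w0|nu w ww].
  - exact: pact0r.
  - by rewrite pactDr v0 w0 addr0.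
  - by apply: contrapT => w0; apply: none; exists nu, w.
have v00 : v0 <> 0 by move=> v00; apply: v0N; rewrite v00 pact0r.
have [E [gr E0]] := weight_grading wM fM indec v00 v0w.
have gen := cyclic_generates gr E0 pim pip r0 pir v0N fM indec.
split; first exact: (cyclic_uniserial gr E0 pip pir gen).
exists r, lam, v0; split; [exact: r0|exact: v0w| | |exact: pir].
- move=> w; have [q wq] := gen w; exists (q %% pi ^+ r); last first.
    exact (etrans wq (esym (modp_act pir q v0))).
  by rewrite ltn_modp monic_neq0 ?monic_exp.
- move=> q sq qv; exact (powers_free gr E0 pip r0 pir v0N sq qv).
Qed.

End WeightGrading.

(** In [V(lam, f)] the last basis vector is sent by [x] to [f_tail], which is what
    remains of [f(x^s)] once its leading term is moved to the other side. *)
Lemma f_tail_relation (k : fieldType) s (g : {poly k}) : (0 < s)%N -> g \is monic ->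
  'X^((size g).-1 * s) - (g \Po 'X^s) = rVpoly (f_tail s g).
Proof.
move=> s0 gm; rewrite /f_tail linear_sum /= comp_polyE.
have sg : size g = (size g).-1.+1.
  by rewrite prednK // size_poly_gt0 monic_neq0.
rewrite [in X in _ - X]sg big_ord_recr /= -lead_coefE (monicP gm) scale1r.
rewrite -exprM [(s * _)%N]mulnC opprD addrCA subrr addr0 -sumrN.
apply: eq_bigr => j _; rewrite [RHS]linearZ /= rVpoly_basis_vec ?ltn_pmul2r //.
by rewrite scaleNr -exprM mulnC.
Qed.

Unset Implicit Arguments.

Theorem theorem4p18 (k : fieldType) (G : groupType) (chi : Ghat k G) (a : G)
    (ha : forall g : G, (a * g)%g = (g * a)%g) (hchia : chi a <> 1)
    (s : nat) (hs : char_order chi s)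
    (M : lmodType (Halg chi)) (hW : weight_module M) (hfd : finite_dim M)
    (hind : indecomposable M) :
  ((exists (t : nat) (lam : Ghat k G),
      (1 <= t)%N /\ module_iso M (V_t chi t lam)) \/
   (exists (lam : Ghat k G) (r : nat) (f : {poly k}),
      [/\ (1 <= r)%N, in_Irr f & module_iso M (V_f hs lam (f ^+ r))])) /\
  uniserial M.
Proof.
have [s0 chis _] := hs.
have [q q0 qM] := annihilating_poly (Hx chi ^+ s) hfd.
have yc h : GRing.comm h (Hx chi ^+ s) by exact/commr_sym/Hx_exp_central.
have [f [e [fm firr feM]]] := primary_annihilator yc hind q0 qM.
have feM' (v : M) : pact (Hx chi) ((f ^+ e) \Po 'X^s) v = 0.
  exact (etrans (esym (pact_comp_Xn (Hx chi) s (f ^+ e) v)) (feM v)).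
have [fX|/eqP fX] := eqVneq f 'X.
  have piN (v : M) : pact (Hx chi) ('X ^+ (s * e)) v = 0.
    by have := feM' v; rewrite fX comp_Xn_poly exprM.
  have [uni [r [lam [v0 [r0 v0w gen free rel]]]]] :=
    primary_cyclic hs hW hfd hind (monicX k) (graded_primeX s0) piN.
  split=> //; left; exists r, lam; split=> //.
  move: gen free; rewrite size_polyXn => gen free.
  apply: (string_iso (@zero_tailP k G chi r) v0w gen free).
  by rewrite linear0 pact0 -pactXn.
have pim : f \Po 'X^s \is monic.
  by rewrite monicE lead_coef_comp ?size_polyXn // (monicP fm) lead_coefXn expr1n mulr1.
have pip : graded_prime s (f \Po 'X^s).
  apply: graded_prime_comp => //; apply/negP => Xf; apply: fX.
  apply/esym/eqP; rewrite -eqp_monic ?monicX //.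
  by apply: (firr.2) Xf; rewrite size_polyX.
have piN (v : M) : pact (Hx chi) ((f \Po 'X^s) ^+ e) v = 0.
  by have := feM' v; rewrite rmorphXn.
have [uni [r [lam [v0 [r0 v0w gen free rel]]]]] := primary_cyclic hs hW hfd hind pim pip piN.
split=> //; right; exists lam, r, f; split=> //.
have piE : (f \Po 'X^s) ^+ r = (f ^+ r) \Po 'X^s by rewrite rmorphXn.
have size_pi : size ((f \Po 'X^s) ^+ r) = ((size (f ^+ r)).-1 * s).+1.
  have := size_comp_poly (f ^+ r) 'X^s; rewrite -piE size_polyXn => <-.
  by rewrite prednK // size_poly_gt0 monic_neq0 // monic_exp.
move: gen free; rewrite size_pi => gen free.
apply: (string_iso (f_tailP hs (f := f ^+ r)) v0w gen free).
by rewrite -f_tail_relation ?monic_exp // -piE pactB pactXn rel subr0.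
Qed.
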